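(* Let $Q$ be a finite acyclic quiver and $K$ a field. Let $x,y,w$ be vertices of $Q$, and let $P(x),P(y),P(w)$ be the corresponding indecomposable projective representations of $Q$ over $K$. Then the multiplicity of $P(w)$ as a direct summand in the decomposition of $P(x)\otimes P(y)$ into indecomposables equals \[ n_{xw}n_{yw}-\sum_{z\to w} n_{xz}n_{yz}, \] where the sum is over all arrows of $Q$ with terminal vertex $w$ (each arrow $z\to w$ contributing the term for its start vertex $z$), and $n_{ij}$ denotes the number of paths from $i$ to $j$ in $Q$.
   Context: A quiver $Q=(Q_0,Q_1,s,t)$ has finite vertex set $Q_0$, finite arrow set $Q_1$, and start/terminal vertex functions $s,t\colon Q_1\to Q_0$; acyclic means no oriented cycles. A representation $V=(V_x,\varphi_\alpha)$ of $Q$ over $K$ assigns a finite dimensional $K$-vector space $V_x$ to each vertex $x$ and a linear map $\varphi_\alpha\colon V_{s(\alpha)}\to V_{t(\alpha)}$ to each arrow $\alpha$. The tensor product is pointwise: $(V\otimes W)_x=V_x\otimes W_x$, with the map $\varphi_\alpha\otimes\psi_\alpha$ over each arrow $\alpha$. Paths include the trivial path at each vertex, so $n_{xx}=1$. The indecomposable projective representation $P(x)$ has at each vertex $y$ the vector space with basis all paths from $x$ to $y$, and the map over an arrow $\alpha\colon y\to z$ sends a path $c$ from $x$ to $y$ to the path $c\alpha$ (first $c$, then $\alpha$). The category of representations has the Krull-Schmidt property, so multiplicities are well defined. *)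

(* Defs.v *)
From HB Require Import structures.
From mathcomp Require Import all_boot all_order all_algebra.
From mathcomp Require Import boolp.

Set Implicit Arguments.
Unset Strict Implicit.
Unset Printing Implicit Defensive.

Import GRing.Theory.
Local Open Scope ring_scope.

Record quiver := Quiver {
  vertex : finType;
  arrow : finType;
  src : arrow -> vertex;
  tgt : arrow -> vertex }.

Arguments src {q} a.
Arguments tgt {q} a.

(* Paths are read from left to right; [::] is the trivial path, a path from   *)
(* each vertex to itself.                                                     *)
Fixpoint is_path (Q : quiver) (x y : vertex Q) (p : seq (arrow Q)) : bool :=
  if p is a :: p' then (src a == x) && is_path (tgt a) y p' else x == y.

Definition acyclic (Q : quiver) : Prop :=
  forall (x : vertex Q) (p : seq (arrow Q)), is_path x x p -> p = [::].

Record acyclicQuiver := AcyclicQuiver {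
  acyclic_quiver :> quiver;
  acyclicP : acyclic acyclic_quiver }.

Record qpath (Q : quiver) (x y : vertex Q) := QPath {
  path_arrows :> seq (arrow Q);
  path_arrowsP : is_path x y path_arrows }.

HB.instance Definition _ (Q : quiver) (x y : vertex Q) :=
  [isSub for @path_arrows Q x y].
HB.instance Definition _ (Q : quiver) (x y : vertex Q) :=
  [Countable of qpath x y by <:].

Lemma is_path_cat (Q : quiver) (x y : vertex Q) (p q : seq (arrow Q)) :
  is_path x y (p ++ q) = is_path x (last x (map tgt p)) p
                         && is_path (last x (map tgt p)) y q.
Proof. by elim: p x => [|a p IHp] x /=; rewrite ?eqxx // IHp andbA. Qed.

Lemma is_path_last (Q : quiver) (x y : vertex Q) (p : seq (arrow Q)) :
  is_path x y p -> last x (map tgt p) = y.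
Proof. by elim: p x => [|a p IHp] x /=; [move/eqP | case/andP=> _ /IHp]. Qed.

Lemma acyclic_path_uniq (Q : acyclicQuiver) (x y : vertex Q)
    (p : seq (arrow Q)) :
  is_path x y p -> uniq (x :: map tgt p).
Proof.
elim: p x => [|a p IHp] x //= /andP[/eqP sax pa]; have /= -> := IHp _ pa.
rewrite andbT; apply/negP => xin.
have [b bin xb] : exists2 b, b \in a :: p & x = tgt b by apply/mapP.
have : is_path x y (a :: p) by rewrite /= sax eqxx.
case/splitPr: bin => p1 p2; rewrite -cat_rcons is_path_cat => /andP[+ _].
rewrite map_rcons last_rcons -xb => /acyclicP.
by case: p1.
Qed.

Lemma acyclic_path_size (Q : acyclicQuiver) (x y : vertex Q) (p : qpath x y) :
  (size p <= #|vertex Q|)%N.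
Proof.
have /acyclic_path_uniq/card_uniqP/= e := path_arrowsP p.
by apply: ltnW; rewrite -(size_map tgt) -e max_card.
Qed.

Section PathFinite.
Variables (Q : acyclicQuiver) (x y : vertex Q).

Let to_bseq (p : qpath x y) : #|vertex Q|.-bseq (arrow Q) :=
  Bseq (acyclic_path_size p).

Fact to_bseqK : pcancel to_bseq (fun b => insub (bseqval b)).
Proof. by move=> p; rewrite /= valK. Qed.

HB.instance Definition _ : isFinite (qpath x y) := PCanIsFinite to_bseqK.
End PathFinite.

Definition npaths (Q : acyclicQuiver) (x y : vertex Q) : nat :=
  #|{: qpath x y}|.

Fact path_rconsP (Q : quiver) (x : vertex Q) (a : arrow Q)
    (c : qpath x (src a)) : is_path x (tgt a) (rcons c a).
Proof.
rewrite -cats1 is_path_cat (is_path_last (path_arrowsP c)) /=.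
by rewrite path_arrowsP !eqxx.
Qed.

Definition path_rcons (Q : quiver) (x : vertex Q) (a : arrow Q)
    (c : qpath x (src a)) : qpath x (tgt a) := QPath (path_rconsP c).

(* The tensor product of finite dimensional vector spaces is realised,        *)
(* independently of bases, as Hom(U^*, V), where u (x) v is the map           *)
(* xi |-> xi(u) v; [tens_universal] is its universal property.                *)
Section Tensor.
Variable K : fieldType.

Definition dual (U : vectType K) : vectType K := 'Hom(U, K^o).

Definition tens (U V : vectType K) : vectType K := 'Hom(dual U, V).

Definition ptens (U V : vectType K) (u : U) (v : V) : tens U V :=
  linfun (fun xi : dual U => xi u *: v).

Definition dual_map (U U' : vectType K) (f : 'Hom(U, U')) :
    'Hom(dual U', dual U) :=
  linfun (fun xi : dual U' => (xi \o f)%VF).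

Definition tens_map (U V U' V' : vectType K) (f : 'Hom(U, U'))
    (g : 'Hom(V, V')) : 'Hom(tens U V, tens U' V') :=
  linfun (fun T : tens U V => (g \o T \o dual_map f)%VF).

(* [linfun h] is a meaningful map only when h is linear. *)
Lemma linfunE (U V : vectType K) (h : U -> V) : linear h -> linfun h =1 h.
Proof.
move=> hl; pose hM := GRing.isLinear.Build _ _ _ _ h hl.
by pose hL : {linear _ -> _} := HB.pack h hM; apply: (lfunE hL).
Qed.

Lemma ptensE (U V : vectType K) (u : U) (v : V) (xi : dual U) :
  ptens u v xi = xi u *: v.
Proof.
rewrite linfunE // => a f g.
by rewrite add_lfunE scale_lfunE scalerDl scalerA.
Qed.

Lemma dual_mapE (U U' : vectType K) (f : 'Hom(U, U')) (xi : dual U') :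
  dual_map f xi = (xi \o f)%VF.
Proof. by rewrite linfunE // => a g h; rewrite comp_lfunDl -comp_lfunZl. Qed.

Lemma tens_mapE (U V U' V' : vectType K) (f : 'Hom(U, U')) (g : 'Hom(V, V'))
    (T : tens U V) : tens_map f g T = (g \o T \o dual_map f)%VF.
Proof.
rewrite linfunE // => a S T'.
by rewrite comp_lfunDr -comp_lfunZr comp_lfunDl -comp_lfunZl.
Qed.

Lemma tens_map_ptens (U V U' V' : vectType K) (f : 'Hom(U, U'))
    (g : 'Hom(V, V')) (u : U) (v : V) :
  tens_map f g (ptens u v) = ptens (f u) (g v).
Proof.
apply/lfunP => xi.
by rewrite tens_mapE !comp_lfunE dual_mapE !ptensE comp_lfunE linearZ.
Qed.

Lemma ptens_linearl (U V : vectType K) (v : V) :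
  linear (fun u : U => ptens u v).
Proof.
move=> a u u'; apply/lfunP => xi.
by rewrite add_lfunE scale_lfunE !ptensE linearP scalerDl scalerA.
Qed.

Lemma ptens_linearr (U V : vectType K) (u : U) :
  linear (fun v : V => ptens u v).
Proof.
move=> a v v'; apply/lfunP => xi.
by rewrite add_lfunE scale_lfunE !ptensE scalerDr !scalerA mulrC.
Qed.

Lemma tens_universal (U V W : vectType K) (b : U -> V -> W) :
    (forall v, linear (b^~ v)) -> (forall u, linear (b u)) ->
  exists! h : 'Hom(tens U V, W), forall u v, h (ptens u v) = b u v.
Proof.
move=> bl br; pose e := vbasis {:U}.
pose ed i : dual U := linfun (coord e i : U -> K^o).
have edE i u : ed i u = coord e i u.
  by rewrite linfunE // => a u1 u2; rewrite linearP.
have eK (u : U) : u = \sum_(i < \dim {:U}) ed i u *: e`_i.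
  rewrite [LHS](coord_vbasis (memvf u)).
  by apply: eq_bigr => i _; rewrite edE.
have tK (T : tens U V) : T = \sum_(i < \dim {:U}) ptens e`_i (T (ed i)).
  apply/lfunP => xi; rewrite sum_lfunE.
  under eq_bigr do rewrite ptensE -linearZ.
  rewrite -linear_sum; congr (T _); apply/lfunP => u.
  rewrite {1}[u]eK linear_sum sum_lfunE; apply: eq_bigr => i _.
  by rewrite scale_lfunE linearZ; apply: mulrC.
pose h0 (T : tens U V) := \sum_(i < \dim {:U}) b e`_i (T (ed i)).
have h0l : linear h0.
  move=> a S T; rewrite /h0 scaler_sumr -big_split; apply: eq_bigr => i _.
  by rewrite add_lfunE scale_lfunE br.
exists (linfun h0); split=> [u v|h hE].
  rewrite linfunE // [in RHS](eK u) -[RHS](linfunE (bl v)) linear_sum.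
  apply: eq_bigr => i _.
  by rewrite ptensE linearZ /= (linfunE (bl v)) -!(linfunE (br e`_i)) linearZ.
apply/lfunP => T; rewrite linfunE // [in RHS](tK T) linear_sum.
by apply: eq_bigr => i _; rewrite /= hE.
Qed.

End Tensor.

Section Representations.
Variable K : fieldType.

Record rep (Q : quiver) := Rep {
  rep_space :> vertex Q -> vectType K;
  rep_map : forall a : arrow Q, 'Hom(rep_space (src a), rep_space (tgt a)) }.

Definition is_morphism (Q : quiver) (V W : rep Q)
    (f : forall x, 'Hom(V x, W x)) : Prop :=
  forall a : arrow Q,
    (f (tgt a) \o rep_map V a)%VF = (rep_map W a \o f (src a))%VF.

Definition rep_iso (Q : quiver) (V W : rep Q) : Prop :=
  exists f : forall x, 'Hom(V x, W x),
    is_morphism f /\ forall x, bijective (f x).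

Definition zero_rep (Q : quiver) : rep Q :=
  @Rep Q (fun=> 'rV[K]_0) (fun=> 0).

Definition dsum_map (U V U' V' : vectType K) (f : 'Hom(U, U'))
    (g : 'Hom(V, V')) : 'Hom((U * V)%type, (U' * V')%type) :=
  linfun (fun uv : U * V => (f uv.1, g uv.2)).

Definition dsum (Q : quiver) (V W : rep Q) : rep Q :=
  @Rep Q (fun x => (V x * W x)%type)
         (fun a => dsum_map (rep_map V a) (rep_map W a)).

Definition tensor (Q : quiver) (V W : rep Q) : rep Q :=
  @Rep Q (fun x => tens (V x) (W x))
         (fun a => tens_map (rep_map V a) (rep_map W a)).

Definition is_zero (Q : quiver) (V : rep Q) : Prop := rep_iso V (zero_rep Q).

Definition indecomposable (Q : quiver) (V : rep Q) : Prop :=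
  ~ is_zero V /\
  forall A B : rep Q, rep_iso V (dsum A B) -> is_zero A \/ is_zero B.

Definition decomposition (Q : quiver) (V : rep Q) (s : seq (rep Q)) : Prop :=
  (forall i, (i < size s)%N -> indecomposable (nth (zero_rep Q) s i)) /\
  rep_iso V (\big[@dsum Q / zero_rep Q]_(M <- s) M).

(* Decompositions exist and, by Krull-Schmidt, all give the same count; both  *)
(* facts are part of the predicate, which hence determines m.                 *)
Definition has_multiplicity (Q : quiver) (M V : rep Q) (m : nat) : Prop :=
  (exists s, decomposition V s) /\
  forall s, decomposition V s -> count (fun N => `[< rep_iso N M >]) s = m.

(* The standard basis vector of K^(I) indexed by i. *)
Definition basis_vec (I : finType) (i : I) : {ffun I -> K^o} :=
  [ffun j => (j == i)%:R].

Definition proj_map (Q : acyclicQuiver) (x : vertex Q) (a : arrow Q) :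
    'Hom({ffun qpath x (src a) -> K^o}, {ffun qpath x (tgt a) -> K^o}) :=
  linfun (fun v : {ffun qpath x (src a) -> K^o} =>
    \sum_(c : qpath x (src a)) (v c : K) *: basis_vec (path_rcons c)).

Definition proj (Q : acyclicQuiver) (x : vertex Q) : rep Q :=
  @Rep Q (fun y => {ffun qpath x y -> K^o}) (@proj_map Q x).

Lemma dsum_mapE (U V U' V' : vectType K) (f : 'Hom(U, U'))
    (g : 'Hom(V, V')) (uv : (U * V)%type) :
  dsum_map f g uv = (f uv.1, g uv.2).
Proof. by rewrite linfunE // => a u v; rewrite /= !linearP. Qed.

Lemma proj_map_basis (Q : acyclicQuiver) (x : vertex Q) (a : arrow Q)
    (c : qpath x (src a)) :
  proj_map x a (basis_vec c) = basis_vec (path_rcons c).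
Proof.
rewrite linfunE => [|k u v].
  rewrite (bigD1 c) //= big1 => [|d /negPf dc]; rewrite !ffunE ?dc ?scale0r //.
  by rewrite eqxx scale1r addr0.
rewrite scaler_sumr -big_split; apply: eq_bigr => d _ /=.
by rewrite !ffunE scalerDl scalerA.
Qed.

End Representations.

(* Main.v *)
(* In P(x) the maps over the arrows ending at a given vertex are jointly      *)
(* split injective, since a nontrivial path determines its last arrow. This   *)
(* property passes to tensor products and direct summands, and a              *)
(* representation having it is a direct sum of P(v)'s: lift bases of the      *)
(* cokernels of the maps into each vertex. For such a V the function          *)
(* dim V_w - sum_(z -> w) dim V_z is additive and equals [v = w] on P(v), so  *)
(* it counts the summands P(w) in any decomposition; no Krull-Schmidt theorem *)
(* is needed.                                                                 *)
Require Import Defs.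
From mathcomp Require Import all_boot all_order all_algebra.
From mathcomp Require Import boolp.

Set Implicit Arguments.
Unset Strict Implicit.
Unset Printing Implicit Defensive.

Import GRing.Theory.
Local Open Scope ring_scope.

(** The idea is to characterise sums of P(v)'s by a condition that tensor products visibly preserve,
    and then to count dimensions. The condition is [into_split]: it holds for P(x)
    ([into_split_proj]), survives tensoring ([into_split_tensor]), and forces a sum of P(v)'s
    ([into_split_proj_sum]). The multiplicity is then read off from [top_dim], the dimension of the
    top at w: by [npaths_rec] it is 1 on P(w) and 0 on every other P(v), so
    [into_split_multiplicity] identifies it with the count. Since P(x) (x) P(y) has dimension n_xz
    n_yz at z, its [top_dim] at w is the stated difference. *)

Section LinearAlgebra.
Variable K : fieldType.

(** * Linear maps, bases, tensor products and direct sums of spaces *)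

Lemma surj_dim_bij (U V : vectType K) (f : 'Hom(U, V)) :
  limg f = fullv -> dim U = dim V -> bijective f.
Proof.
move=> fS dUV; have kf : lker f == 0%VS.
  have := limg_ker_dim f fullv; rewrite capfv fS !dimvf dUV -dimv_eq0 => e.
  by rewrite -(eqn_add2r (dim V)) e.
exists f^-1%VF; first exact: lker0_lfunK.
by move=> v; rewrite limg_lfunVK // fS memvf.
Qed.

Lemma bij_lker0 (U V : vectType K) (f : 'Hom(U, V)) :
  bijective f -> lker f == 0%VS.
Proof. by move/bij_inj => fI; apply/lker0P. Qed.

Lemma bij_lfunVK (U V : vectType K) (f : 'Hom(U, V)) :
  bijective f -> cancel f^-1%VF f.
Proof.
move=> fB; have [g _ gK] := fB; move=> v.
by rewrite limg_lfunVK // -(gK v) memv_img ?memvf.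
Qed.

Lemma bij_dim (U V : vectType K) (f : 'Hom(U, V)) :
  bijective f -> dim U = dim V.
Proof.
move=> fB; have := limg_ker_dim f fullv.
rewrite (eqP (bij_lker0 fB)) capv0 dimv0 add0n dimvf => <-.
rewrite -dimvf; congr (\dim _); apply/vspaceP=> v.
by rewrite memvf -(bij_lfunVK fB v) memv_img ?memvf.
Qed.

(** A tensor is a map from Hom(U, K) to V, so its dimension unfolds to (dim U * 1) * dim V. *)
Lemma dim_tens (U V : vectType K) : dim (tens U V) = (dim U * dim V)%N.
Proof. by rewrite -[RHS]/(dim U * dim V)%N -[dim U]muln1. Qed.

Lemma dim_ffun (I : finType) : dim {ffun I -> K^o} = #|I|.
Proof. exact: muln1. Qed.

Lemma basis_vecE (I : finType) (i j : I) :
  basis_vec K i j = (j == i)%:R.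
Proof. by rewrite ffunE. Qed.

Lemma ffun_basis (I : finType) (b : {ffun I -> K^o}) :
  b = \sum_i (b i : K) *: basis_vec K i.
Proof.
apply/ffunP=> j; rewrite sum_ffunE (bigD1 j) //= big1 => [|i /negPf ij].
  by rewrite !ffunE eqxx addr0; apply/esym/mulr1.
by rewrite !ffunE eq_sym ij; apply: mulr0.
Qed.

Lemma eq_basis_hom (I : finType) (U : vectType K)
    (f g : 'Hom({ffun I -> K^o}, U)) :
  (forall i, f (basis_vec K i) = g (basis_vec K i)) -> f = g.
Proof.
move=> fg; apply/lfunP=> b; rewrite (ffun_basis b) !linear_sum.
by apply: eq_bigr => i _; rewrite !linearZ /= fg.
Qed.

Definition basis_hom (I : finType) (U : vectType K) (h : I -> U) :
    'Hom({ffun I -> K^o}, U) :=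
  linfun (fun b : {ffun I -> K^o} => \sum_i (b i : K) *: h i).

Lemma basis_homE (I : finType) (U : vectType K) (h : I -> U) (i : I) :
  basis_hom h (basis_vec K i) = h i.
Proof.
rewrite linfunE => [|k u v].
  rewrite (bigD1 i) //= big1 => [|j /negPf ji]; rewrite ffunE ?ji ?scale0r //.
  by rewrite eqxx scale1r addr0.
rewrite scaler_sumr -big_split; apply: eq_bigr => j _ /=.
by rewrite !ffunE scalerDl scalerA.
Qed.

Lemma tens_map_comp (U V U' V' U'' V'' : vectType K) (f' : 'Hom(U', U''))
    (f : 'Hom(U, U')) (g' : 'Hom(V', V'')) (g : 'Hom(V, V')) :
  (tens_map f' g' \o tens_map f g)%VF = tens_map (f' \o f)%VF (g' \o g)%VF.
Proof.
apply/lfunP=> T; rewrite comp_lfunE !tens_mapE; apply/lfunP=> xi.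
by rewrite !comp_lfunE !dual_mapE comp_lfunA.
Qed.

Lemma tens_map1 (U V : vectType K) :
  tens_map (\1%VF : 'Hom(U, U)) (\1%VF : 'Hom(V, V)) = \1%VF.
Proof.
apply/lfunP=> T; rewrite tens_mapE; apply/lfunP=> xi.
by rewrite !comp_lfunE !id_lfunE dual_mapE comp_lfun1r.
Qed.

Lemma tens_map0 (U V U' V' : vectType K) (f : 'Hom(U, U')) :
  tens_map f (0 : 'Hom(V, V')) = 0.
Proof. by apply/lfunP=> T; rewrite tens_mapE !comp_lfun0l zero_lfunE. Qed.

Definition fst_hom (U V : vectType K) : 'Hom((U * V)%type, U) := linfun fst.
Definition snd_hom (U V : vectType K) : 'Hom((U * V)%type, V) := linfun snd.
Definition inl_hom (U V : vectType K) : 'Hom(U, (U * V)%type) :=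
  linfun (fun u => (u, 0)).
Definition inr_hom (U V : vectType K) : 'Hom(V, (U * V)%type) :=
  linfun (fun v => (0, v)).

Lemma fst_homE (U V : vectType K) uv : fst_hom U V uv = uv.1.
Proof. by rewrite linfunE. Qed.
Lemma snd_homE (U V : vectType K) uv : snd_hom U V uv = uv.2.
Proof. by rewrite linfunE. Qed.
Lemma inl_homE (U V : vectType K) u : inl_hom U V u = (u, 0).
Proof.
rewrite linfunE // => k a b; congr pair => /=.
by rewrite scaler0 addr0.
Qed.
Lemma inr_homE (U V : vectType K) v : inr_hom U V v = (0, v).
Proof.
rewrite linfunE // => k a b; congr pair => /=.
by rewrite scaler0 addr0.
Qed.

End LinearAlgebra.

(** * Isomorphisms and direct sums of representations *)

Section Representations.
Variables (K : fieldType) (Q : quiver).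
Implicit Types (U V W : rep K Q) (v w : vertex Q) (a b : arrow Q).

Lemma rep_iso_refl V : rep_iso V V.
Proof.
exists (fun=> \1%VF); split=> [a|x]; first by rewrite comp_lfun1l comp_lfun1r.
by exists id => u; rewrite id_lfunE.
Qed.

Lemma rep_iso_inv V W (f : forall x, 'Hom(V x, W x)) :
    is_morphism f -> (forall x, bijective (f x)) ->
  is_morphism (fun x => (f x)^-1%VF).
Proof.
move=> fM fB a; apply/lfunP=> u; apply: (bij_inj (fB _)).
rewrite !comp_lfunE /= bij_lfunVK // -[RHS]comp_lfunE fM comp_lfunE.
by rewrite bij_lfunVK.
Qed.

Lemma rep_iso_sym V W : rep_iso V W -> rep_iso W V.
Proof.
case=> f [fM fB]; exists (fun x => (f x)^-1%VF).
split; first exact: rep_iso_inv.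
move=> x; exists (f x); first exact: bij_lfunVK.
exact/lker0_lfunK/bij_lker0.
Qed.

Lemma comp_morphism U V W (g : forall x, 'Hom(V x, W x))
    (f : forall x, 'Hom(U x, V x)) :
  is_morphism g -> is_morphism f -> is_morphism (fun x => (g x \o f x)%VF).
Proof. by move=> gM fM a; rewrite -comp_lfunA fM !comp_lfunA gM. Qed.

Lemma rep_iso_trans V U W : rep_iso U V -> rep_iso V W -> rep_iso U W.
Proof.
case=> f [fM fB] [g [gM gB]]; exists (fun x => (g x \o f x)%VF).
split=> [|x]; first exact: comp_morphism.
by apply: (eq_bij (bij_comp (gB x) (fB x))) => u; rewrite comp_lfunE.
Qed.

Lemma rep_iso_dim V W : rep_iso V W -> forall x, dim (V x) = dim (W x).
Proof. by case=> f [_ fB] x; apply: bij_dim (fB x). Qed.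

Lemma inl_morphism V W :
  is_morphism
    (fun x => inl_hom (V x) (W x) : 'Hom(V x, dsum V W x)).
Proof.
move=> a; apply/lfunP=> u; rewrite !comp_lfunE !inl_homE dsum_mapE /=.
by rewrite linear0.
Qed.

Lemma inr_morphism V W :
  is_morphism
    (fun x => inr_hom (V x) (W x) : 'Hom(W x, dsum V W x)).
Proof.
move=> a; apply/lfunP=> u; rewrite !comp_lfunE !inr_homE dsum_mapE /=.
by rewrite linear0.
Qed.

Lemma fst_morphism V W :
  is_morphism
    (fun x => fst_hom (V x) (W x) : 'Hom(dsum V W x, V x)).
Proof.
by move=> a; apply/lfunP=> u; rewrite !comp_lfunE !fst_homE dsum_mapE.
Qed.

Lemma snd_morphism V W :
  is_morphism
    (fun x => snd_hom (V x) (W x) : 'Hom(dsum V W x, W x)).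
Proof.
by move=> a; apply/lfunP=> u; rewrite !comp_lfunE !snd_homE dsum_mapE.
Qed.

Lemma zero_repP V : is_zero V -> forall x (u : V x), u = 0.
Proof.
case=> f [_ fB] x u; apply: (bij_inj (fB x)).
by rewrite [LHS]thinmx0 [RHS]thinmx0.
Qed.

Lemma dsum_zero V W : is_zero W -> rep_iso (dsum V W) V.
Proof.
move=> /zero_repP W0; exists (fun x => fst_hom (V x) (W x)).
split=> [|x]; first exact: fst_morphism.
exists (inl_hom _ _) => u; rewrite inl_homE fst_homE //.
by case: u => u z /=; rewrite (W0 x z).
Qed.

(* Total in v and w (zero when they differ), so that sums over the arrows     *)
(* ending at w need no equality proofs in their types.                        *)
Definition vertex_cast V v w : 'Hom(V v, V w) :=
  if v =P w is ReflectT e then ecast z 'Hom(V v, V z) e \1%VF else 0.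

Lemma vertex_cast_id V v : vertex_cast V v v = \1%VF.
Proof.
by rewrite /vertex_cast; case: eqP => // e; rewrite (eq_axiomK e).
Qed.

Lemma vertex_cast_neq V v w : v != w -> vertex_cast V v w = 0.
Proof. by rewrite /vertex_cast; case: eqP. Qed.

(** * Maps into a vertex and their splittings *)

Definition arrow_into V w a : 'Hom(V (src a), V w) :=
  (vertex_cast V (tgt a) w \o rep_map V a)%VF.

Lemma arrow_into_tgt V a : arrow_into V (tgt a) a = rep_map V a.
Proof. by rewrite /arrow_into vertex_cast_id comp_lfun1l. Qed.

Lemma arrow_into_neq V w a : tgt a != w -> arrow_into V w a = 0.
Proof. by move=> ?; rewrite /arrow_into vertex_cast_neq // comp_lfun0l. Qed.

Lemma arrow_into_morphism V W (f : forall x, 'Hom(V x, W x)) w a :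
    is_morphism f ->
  (f w \o arrow_into V w a)%VF = (arrow_into W w a \o f (src a))%VF.
Proof.
move=> fM; have [<-|aw] := eqVneq (tgt a) w.
  by rewrite !arrow_into_tgt fM.
by rewrite !arrow_into_neq // comp_lfun0l comp_lfun0r.
Qed.

Lemma arrow_into_tensor V W w a :
  arrow_into (tensor V W) w a = tens_map (arrow_into V w a) (arrow_into W w a).
Proof.
have [<-|aw] := eqVneq (tgt a) w; first by rewrite !arrow_into_tgt.
by rewrite !arrow_into_neq // tens_map0.
Qed.

(* Over an acyclic quiver, these are exactly the projective representations.  *)
Definition into_split V : Prop :=
  forall a, exists q : 'Hom(V (tgt a), V (src a)),
    (q \o rep_map V a = \1)%VF /\
    forall b, b != a -> (q \o arrow_into V (tgt a) b = 0)%VF.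

(** If q splits the map of W over an arrow, then g q f splits that of V, as f carries images of
    arrows in V into those in W. Isomorphisms and both direct summands are instances. *)
Lemma into_split_retract V W (f : forall x, 'Hom(V x, W x))
    (g : forall x, 'Hom(W x, V x)) :
    is_morphism f -> is_morphism g -> (forall x, cancel (f x) (g x)) ->
  into_split W -> into_split V.
Proof.
move=> fM gM fK Ws a; have [q [q1 q0]] := Ws a.
exists (g (src a) \o q \o f (tgt a))%VF; split.
  rewrite -!comp_lfunA fM (comp_lfunA q) q1 comp_lfun1l.
  by apply/lfunP=> u; rewrite comp_lfunE fK id_lfunE.
move=> b ba; rewrite -!comp_lfunA (arrow_into_morphism _ _ fM) (comp_lfunA q).
by rewrite q0 // comp_lfun0l comp_lfun0r.
Qed.

Lemma into_split_iso V W : rep_iso V W -> into_split W -> into_split V.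
Proof.
case=> f [fM fB]; apply: (into_split_retract fM (rep_iso_inv fM fB)) => x.
exact/lker0_lfunK/bij_lker0.
Qed.

Lemma into_split_dsuml V W : into_split (dsum V W) -> into_split V.
Proof.
apply: (into_split_retract (@inl_morphism V W) (@fst_morphism V W)) => x u.
by rewrite fst_homE inl_homE.
Qed.

Lemma into_split_dsumr V W : into_split (dsum V W) -> into_split W.
Proof.
apply: (into_split_retract (@inr_morphism V W) (@snd_morphism V W)) => x u.
by rewrite snd_homE inr_homE.
Qed.

(** The tensor product of the two splittings works: on another arrow it already vanishes in one
    factor. *)
Lemma into_split_tensor V W :
  into_split V -> into_split W -> into_split (tensor V W).
Proof.
move=> Vs Ws a; have [[p [p1 p0]] [q [q1 q0]]] := (Vs a, Ws a).
exists (tens_map p q); split; first by rewrite tens_map_comp p1 q1 tens_map1.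
move=> b ba; rewrite arrow_into_tensor tens_map_comp.
by rewrite [X in tens_map _ X]q0 // tens_map0.
Qed.

(** * The radical at a vertex and the dimension of the top *)

Definition radical V w : {vspace V w} :=
  (\sum_(a | tgt a == w) limg (arrow_into V w a))%VS.

(** The splittings make the sum of images direct and each incoming map injective. *)
Lemma dim_radical V w : into_split V ->
  \dim (radical V w) = (\sum_(a | tgt a == w) dim (V (src a)))%N.
Proof.
move=> Vs; rewrite /radical.
have dS : directv (\sum_(a | tgt a == w) limg (arrow_into V w a))%VS.
  apply/directv_sum_independent => us usE us0 a /eqP aw; subst w.
  have [q [q1 q0]] := Vs a.
  have [m _ um] := memv_imgP (usE a (eqxx _)).
  (* Applying q to the relation leaves only its component over a. *)
  have := congr1 q us0; rewrite linear_sum linear0 (bigD1 a) //= big1.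
    rewrite addr0 um arrow_into_tgt -comp_lfunE q1 id_lfunE => ->.
    by rewrite linear0.
  move=> b /andP[bw ba]; have [n _ ->] := memv_imgP (usE b bw).
  by rewrite -comp_lfunE q0 // zero_lfunE.
rewrite (directvP dS) /=; apply: eq_bigr => a /eqP aw; subst w.
rewrite -dimvf limg_dim_eq // arrow_into_tgt; apply/eqP.
have [q [q1 _]] := Vs a.
rewrite -subv0; apply/subvP=> u /memv_capP[_].
rewrite memv_ker memv0 => /eqP u0.
by rewrite -[u]id_lfunE -q1 comp_lfunE u0 linear0.
Qed.

(** For [into_split] V this is the dimension of V_w modulo its radical. It is an integer because for
    a general V the difference can be negative. *)
Definition top_dim V w : int :=
  (dim (V w))%:Z - (\sum_(a | tgt a == w) dim (V (src a)))%:Z.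

Lemma top_dim_iso V W w : rep_iso V W -> top_dim V w = top_dim W w.
Proof.
move=> /rep_iso_dim VW; rewrite /top_dim VW; congr (_ - Posz _).
by apply: eq_bigr => a _; rewrite VW.
Qed.

Lemma top_dim_dsum V W w : top_dim (dsum V W) w = top_dim V w + top_dim W w.
Proof.
rewrite /top_dim [dim _]/(dim (V w) + dim (W w))%N.
under eq_bigr do rewrite [dim _]/(dim (V _) + dim (W _))%N.
by rewrite big_split /= !PoszD opprD addrACA.
Qed.

Lemma top_dim_zero w : top_dim (zero_rep K Q) w = 0.
Proof. by rewrite /top_dim big1. Qed.

Lemma top_dim_bigdsum (s : seq (rep K Q)) w :
  top_dim (\big[@dsum K Q / zero_rep K Q]_(M <- s) M) w
    = \sum_(M <- s) top_dim M w.
Proof.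
elim: s => [|M s IHs]; first by rewrite !big_nil top_dim_zero.
by rewrite !big_cons top_dim_dsum IHs.
Qed.

End Representations.

(** * Induction along arrows and path counting *)

Section AcyclicQuiver.
Variable Q : acyclicQuiver.
Implicit Types (v w x : vertex Q) (a b : arrow Q).

Definition trivial_path v : qpath v v := @QPath Q v v [::] (eqxx v).

Lemma vertex_ind (P : vertex Q -> Prop) :
  (forall w, (forall a, tgt a = w -> P (src a)) -> P w) -> forall w, P w.
Proof.
move=> IH w; suff H n : forall w,
    (forall v (p : qpath v w), size p < n)%N -> P w.
  by apply: (H #|vertex Q|.+1) => v p; rewrite ltnS acyclic_path_size.
elim: n => [|n IHn] {}w wn.
  by have := wn w (trivial_path w).
apply: IH => a aw; apply: IHn => v p; subst w.
by have := wn v (path_rcons p); rewrite /= size_rcons.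
Qed.

Lemma is_path_rcons v w a (p : seq (arrow Q)) :
  is_path v w (rcons p a) = is_path v (src a) p && (tgt a == w).
Proof.
elim: p v => [|b p IHp] v /=; first by rewrite eq_sym.
by rewrite IHp andbA.
Qed.

Lemma card_qpath_last v a :
  #|[set c : qpath v (tgt a) | ohead (rev c) == Some a]| = npaths v (src a).
Proof.
have rI : injective (@path_rcons Q v a).
  by move=> c d /(congr1 val)/rcons_inj[cd]; apply: val_inj.
rewrite /npaths -cardsT -(card_imset _ rI); apply: eq_card => c; rewrite inE.
apply/idP/imsetP => [|[d _ ->]]; last by rewrite /= rev_rcons.
case: c => p; case/lastP: p => [|p b] //= pP; rewrite rev_rcons => /eqP[eb].
subst b; have dP : is_path v (src a) p.
  by move: pP; rewrite is_path_rcons => /andP[].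
by exists (QPath dP) => //; apply: val_inj.
Qed.

(** Paths are sorted by their last arrow, which is [None] exactly for the trivial path. *)
Lemma npaths_rec v w :
  npaths v w = ((v == w) + \sum_(a | tgt a == w) npaths v (src a))%N.
Proof.
pose last_arrow (c : qpath v w) := ohead (rev c).
rewrite {1}/npaths -sum1_card (partition_big last_arrow predT) //=.
rewrite [LHS](bigD1 None) //= /last_arrow; congr addn.
  rewrite sum1dep_card; have [vw|vw] := eqVneq v w.
    subst w; rewrite -[RHS](cards1 (trivial_path v)); apply: eq_card => c.
    rewrite !inE; apply/idP/eqP => [|-> //].
    case: c => p; case/lastP: p => [|p b] //= pP.
      by move=> _; apply: val_inj.
    by rewrite rev_rcons.
  apply: eq_card0 => c; rewrite inE; case: c => p.
  case/lastP: p => [|p b] //= pP; last by rewrite rev_rcons.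
  by rewrite pP in vw.
rewrite (reindex_omap Some id) /=; last by case.
rewrite [RHS]big_mkcond; apply: eq_big => [a|a _]; first by rewrite eqxx.
rewrite sum1dep_card; case: eqP => [aw|aw].
  by subst w; apply: card_qpath_last.
apply: eq_card0 => c; rewrite inE; apply/eqP; case: c => p.
case/lastP: p => [|p b] //= pP; rewrite rev_rcons => -[eb]; apply: aw.
by move: pP; rewrite is_path_rcons eb => /andP[_ /eqP].
Qed.

(** * Projective representations *)

Section Projective.
Variable K : fieldType.
Implicit Types V W : rep K Q.

Lemma top_dim_proj v w : top_dim (proj K v) w = (v == w)%:Z.
Proof.
rewrite /top_dim dim_ffun -[#|_|]/(npaths v w) npaths_rec PoszD.
under [X in _ - Posz X]eq_bigr do rewrite dim_ffun.
exact: addrK.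
Qed.

Lemma rep_map_proj x a (c : qpath x (src a)) :
  rep_map (proj K x) a (basis_vec K c) = basis_vec K (path_rcons c).
Proof. exact: proj_map_basis. Qed.

(** The comparison is made on arrow lists, since the two paths have different types. *)
Lemma arrow_into_proj x w b (c : qpath x (src b)) (d : qpath x w) :
  tgt b = w ->
  arrow_into (proj K x) w b (basis_vec K c) d = ((d : seq _) == rcons c b)%:R.
Proof.
move=> bw; subst w; rewrite arrow_into_tgt rep_map_proj.
by rewrite basis_vecE.
Qed.

Lemma into_split_proj x : into_split (proj K x).
Proof.
(* The splitting keeps the paths ending in a and deletes that last arrow; paths ending in another
   arrow are killed. *)
move=> a; pose q0 (u : {ffun qpath x (tgt a) -> K^o}) :
    {ffun qpath x (src a) -> K^o} := [ffun c => u (path_rcons c)].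
have q0l : linear q0 by move=> k u u'; apply/ffunP=> c; rewrite !ffunE.
exists (linfun q0); split.
  apply: eq_basis_hom => c; rewrite comp_lfunE id_lfunE linfunE //.
  rewrite rep_map_proj; apply/ffunP=> d.
  rewrite ffunE !basis_vecE -[LHS]/((rcons d a == rcons c a)%:R).
  by rewrite eqseq_rcons eqxx andbT.
move=> b ba; apply: eq_basis_hom => c; rewrite comp_lfunE zero_lfunE linfunE //.
apply/ffunP=> d; rewrite !ffunE; have [ta|ta] := eqVneq (tgt b) (tgt a).
  by rewrite arrow_into_proj // eqseq_rcons [a == b]eq_sym (negPf ba) andbF.
by rewrite arrow_into_neq // zero_lfunE ffunE.
Qed.

(* The action of a path, given as the list of its arrows from last to first. *)
Fixpoint rev_act V v (u : V v) (p : seq (arrow Q)) w : V w :=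
  if p is a :: p' then arrow_into V w a (rev_act u p' (src a))
  else vertex_cast V v w u.

(** Yoneda: a path c is sent to its action on u. Reversing c turns appending an arrow into one
    unfolding of [rev_act]. *)
Lemma proj_hom V v (u : V v) :
  exists f : forall w, 'Hom(proj K v w, V w),
    is_morphism f /\ f v (basis_vec K (trivial_path v)) = u.
Proof.
exists (fun w => basis_hom (fun c : qpath v w => rev_act u (rev c) w)).
split=> [a|]; last by rewrite basis_homE /= vertex_cast_id id_lfunE.
apply: eq_basis_hom => c; rewrite !comp_lfunE rep_map_proj.
by rewrite !basis_homE /= rev_rcons /= arrow_into_tgt.
Qed.

Lemma bigdsum_proj_hom V (l : seq {v : vertex Q & V v}) :
  exists f : forall w,
      'Hom((\big[@dsum K Q / zero_rep K Q]_(g <- l) proj K (tag g)) w, V w),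
    is_morphism f /\
    forall v (u : V v), Tagged (fun z => V z) u \in l -> u \in limg (f v).
Proof.
elim: l => [|[v u] l [f [fM fP]]].
  rewrite big_nil; exists (fun=> 0); split=> // a.
  by rewrite comp_lfun0l comp_lfun0r.
have [g [gM gP]] := proj_hom u; rewrite big_cons /=.
set F := (\big[_ / _]_(_ <- _) _) in f fM fP *.
exists (fun w => (g w \o fst_hom (proj K v w) (F w))%VF
                 + (f w \o snd_hom (proj K v w) (F w))%VF).
split=> [a|w u'].
  apply/lfunP=> z; rewrite !(comp_lfunE, add_lfunE) !(fst_homE, snd_homE).
  rewrite dsum_mapE /= linearD -!comp_lfunE fM gM.
  by rewrite [LHS]/= !comp_lfunE.
rewrite in_cons => /orP[/eqP e|/fP /memv_imgP[z _ ->]].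
  have vw : v = w by exact: (esym (congr1 tag e)).
  subst w; have {e} -> : u' = u.
    by apply/eqP; move/eqP: e; rewrite eq_Tagged.
  apply/memv_imgP; exists (basis_vec K (trivial_path v), 0); first exact: memvf.
  by rewrite add_lfunE !comp_lfunE fst_homE snd_homE linear0 addr0.
apply/memv_imgP; exists (0, z); first exact: memvf.
by rewrite add_lfunE !comp_lfunE fst_homE snd_homE linear0 add0r.
Qed.

Lemma top_dim_bigdsum_proj (l : seq (vertex Q)) w :
  top_dim (\big[@dsum K Q / zero_rep K Q]_(v <- l) proj K v) w
    = (count_mem w l)%:Z.
Proof.
elim: l => [|v l IHl]; first by rewrite big_nil top_dim_zero.
by rewrite big_cons top_dim_dsum IHl top_dim_proj /= PoszD.
Qed.

(* Lifts of bases of the tops V_w / rad_w generate V freely: they generate    *)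
(* it by induction along the arrows, and then the dimensions agree.           *)
Lemma into_split_proj_sum V : into_split V ->
  exists l : seq (vertex Q),
    rep_iso V (\big[@dsum K Q / zero_rep K Q]_(v <- l) proj K v).
Proof.
move=> Vs; pose gens v :=
  [seq Tagged (fun z => V z) u | u <- vbasis (radical V v)^C%VS].
pose l := flatten [seq gens v | v <- index_enum (vertex Q)].
have countl w : count_mem w (map tag l) = (dim (V w) - \dim (radical V w))%N.
  rewrite -dimvf -dimv_compl -(size_tuple (vbasis (radical V w)^C%VS)).
  rewrite /l map_flatten count_flatten -!map_comp sumnE big_map /=.
  rewrite (bigD1 w) //= big1 => [|v /negPf vw].
    rewrite addn0 count_map /gens count_map.
    apply/eqP; rewrite -all_count; apply/allP=> u _; apply: eqxx.
  rewrite count_map /gens count_map; apply/eqP; rewrite eqn0Ngt -has_count.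
  by apply/hasPn=> u _ /=; rewrite vw.
have [f [fM fP]] := bigdsum_proj_hom l.
exists (map tag l); rewrite big_map; apply: rep_iso_sym.
set F := (\big[_ / _]_(_ <- _) _) in f fM fP *.
exists f; split=> // w; apply: surj_dim_bij; last first.
  (* Both sides have the same top dimension at w and, by induction, the same dimensions at the
     sources of arrows into w. *)
  elim/vertex_ind: w => w IHw.
  have := top_dim_bigdsum_proj (map tag l) w.
  rewrite big_map -/F countl /top_dim dim_radical // => /eqP.
  rewrite (eq_bigr (fun a => dim (V (src a)))); last by move=> a /eqP/IHw.
  (* The truncated subtraction in [countl] is a true difference, the radical being a subspace. *)
  rewrite -subzn; last by rewrite -dim_radical // -dimvf dimvS ?subvf.
  by rewrite (inj_eq (addIr _)) => /eqP[].
(* The radical is reached by induction through the incoming arrows, its complement through the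
   chosen generators. *)
elim/vertex_ind: w => w IHw.
apply/eqP; rewrite eqEsubv subvf /=.
rewrite -(addv_complf (radical V w)) subv_add; apply/andP; split.
  apply/subv_sumP => a /eqP aw; subst w; apply/subvP=> _ /memv_imgP[u _ ->].
  have /memv_imgP[z _ ->] : u \in limg (f (src a)) by rewrite IHw ?memvf.
  by rewrite arrow_into_tgt -comp_lfunE -fM comp_lfunE memv_img ?memvf.
rewrite -(span_basis (vbasisP (radical V w)^C%VS)).
apply/span_subvP=> u uB; apply: fP.
apply/flatten_mapP; exists w; first by rewrite mem_index_enum.
by apply/mapP; exists u.
Qed.

(** * Indecomposability and multiplicities *)

Lemma top_dim_is_zero V w : is_zero V -> top_dim V w = 0.
Proof. by move/(top_dim_iso w) ->; apply: top_dim_zero. Qed.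

Lemma proj_nonzero v : ~ is_zero (proj K v).
Proof. by move/(top_dim_is_zero v); rewrite top_dim_proj eqxx. Qed.

(** Both summands are sums of P(u)'s, and [top_dim] shows that together they involve a single P(v),
    so one of the two lists is empty. *)
Lemma proj_indecomposable v : indecomposable (proj K v).
Proof.
split=> [|A B vAB]; first exact: proj_nonzero.
have ABs := into_split_iso (rep_iso_sym vAB) (into_split_proj v).
have [lA isoA] := into_split_proj_sum (into_split_dsuml ABs).
have [lB isoB] := into_split_proj_sum (into_split_dsumr ABs).
have count1 u : (count_mem u lA + count_mem u lB)%N = (v == u).
  apply/eqP; rewrite -eqz_nat PoszD -!(top_dim_bigdsum_proj _ u).
  rewrite -(top_dim_iso u isoA) -(top_dim_iso u isoB) -top_dim_dsum.
  by rewrite -(top_dim_iso u vAB) top_dim_proj.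
case: lA isoA count1 => [|u lA] isoA count1.
  by left; rewrite big_nil in isoA.
case: lB isoB count1 => [|u' lB] isoB count1.
  by right; rewrite big_nil in isoB.
have vu : v = u by have := count1 u; rewrite /= eqxx; case: (v =P u).
have vu' : v = u' by have := count1 u'; rewrite /= eqxx addnCA; case: (v =P u').
by have := count1 v; rewrite -vu -vu' /= eqxx addnCA.
Qed.

Lemma indecomposable_into_split V :
  indecomposable V -> into_split V -> exists v, rep_iso V (proj K v).
Proof.
case=> V0 Vind /into_split_proj_sum[[|v l]]; rewrite ?big_nil // big_cons => e.
have [/proj_nonzero //|l0] := Vind _ _ e.
by exists v; apply: rep_iso_trans e (dsum_zero _ l0).
Qed.

Lemma rep_iso_proj v w : `[< rep_iso (proj K v) (proj K w) >] = (v == w).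
Proof.
apply/asboolP/eqP => [/(top_dim_iso w)|->]; last exact: rep_iso_refl.
by rewrite !top_dim_proj eqxx; case: eqP.
Qed.

Lemma into_split_bigdsum (s : seq (rep K Q)) i : (i < size s)%N ->
    into_split (\big[@dsum K Q / zero_rep K Q]_(M <- s) M) ->
  into_split (nth (zero_rep K Q) s i).
Proof.
elim: s i => [|M s IHs] [|i] //= is_; rewrite big_cons.
  exact: into_split_dsuml.
by move/into_split_dsumr; apply: IHs.
Qed.

(** Every indecomposable summand of V is again [into_split], hence some P(v), and adds [v = w] to
    the additive [top_dim]. So all decompositions give the same count. *)
Lemma into_split_multiplicity V w : into_split V ->
  exists2 m : nat, has_multiplicity (proj K w) V m & m%:Z = top_dim V w.
Proof.
move=> Vs; have [l lV] := into_split_proj_sum Vs.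
exists (count_mem w l); last by rewrite (top_dim_iso w lV) top_dim_bigdsum_proj.
split.
  exists (map (@proj K Q) l); split; last by rewrite big_map.
  (* [nth_map] needs a default vertex; any member of the nonempty list l serves. *)
  move=> i; rewrite size_map => il; have [v0 _] : exists v0, v0 \in l.
    by exists (tnth (in_tuple l) (Ordinal il)); apply: mem_tnth.
  by rewrite (nth_map v0) //; apply: proj_indecomposable.
move=> s [sI sV]; apply/eqP; rewrite -eqz_nat -top_dim_bigdsum_proj.
rewrite -(top_dim_iso w lV) (top_dim_iso w sV) top_dim_bigdsum.
have ss i (si : (i < size s)%N) := into_split_bigdsum si
  (into_split_iso (rep_iso_sym sV) Vs).
(* The hypotheses on s are reduced to one that passes to tails, as the induction requires. *)
have {sI ss sV} : forall i, (i < size s)%N ->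
    exists v, rep_iso (nth (zero_rep K Q) s i) (proj K v).
  by move=> i si; apply: indecomposable_into_split; [apply: sI | apply: ss].
elim: s => [|M s IHs] sP; first by rewrite big_nil.
rewrite big_cons /= PoszD (eqP (IHs _)); last by move=> i; apply: (sP i.+1).
have /= [v Mv] := sP 0%N isT.
rewrite (top_dim_iso w Mv) top_dim_proj -rep_iso_proj.
rewrite (asbool_equiv_eq (Q := rep_iso (proj K v) (proj K w))) //.
by split; apply: rep_iso_trans => //; apply: rep_iso_sym.
Qed.

End Projective.
End AcyclicQuiver.

Theorem theorem1 (K : fieldType) (Q : acyclicQuiver) (x y w : vertex Q) :
  exists m : nat,
    has_multiplicity (proj K w) (tensor (proj K x) (proj K y)) m /\
    m%:Z = (npaths x w)%:Z * (npaths y w)%:Z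
           - \sum_(a : arrow Q | tgt a == w)
               (npaths x (src a))%:Z * (npaths y (src a))%:Z.
Proof.
have [m mP mE] := into_split_multiplicity w
  (into_split_tensor (into_split_proj K x) (into_split_proj K y)).
exists m; split=> //; rewrite mE /top_dim dim_tens !dim_ffun PoszM.
congr (_ - _).
rewrite -natz natr_sum; apply: eq_bigr => a _.
by rewrite natz dim_tens !dim_ffun PoszM.
Qed.
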